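(* Let $A$ be an $n\times n$ complex matrix, let $B=A-\frac{\operatorname{tr}A}{n}I$, and let $\lambda_1(B),\dots,\lambda_n(B)$ be the eigenvalues of $B$ (with multiplicity). Then for every positive integer $r$, all the eigenvalues of $A$ are contained in the disk $$\left| z-\frac{\operatorname{tr}A}{n}\right|\le\left(\frac{(n-1)^{2r-1}}{1+(n-1)^{2r-1}}\sum_{i=1}^n|\lambda_i(B)|^{2r}\right)^{\frac1{2r}}.$$
   Context: $\operatorname{tr}$ denotes the trace and $I$ the $n\times n$ identity matrix. *)

(* Defs.v *)
From mathcomp Require Import all_boot all_order all_algebra.
From mathcomp Require Import reals complex.
Set Implicit Arguments. Unset Strict Implicit. Unset Printing Implicit Defensive.
Import GRing.Theory Num.Theory.
Local Open Scope ring_scope.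

(* Complex numbers are [R[i]] with [R : realType].  The modulus [`|z|] lives in
   [R[i]] as a nonnegative real, and [x <= y] there means that [y - x] is a
   nonnegative real, so it restricts to the usual order on reals.  On
   nonnegative reals, [m.-root] with [m > 0] is the nonnegative m-th root. *)

(* [lambda] lists the eigenvalues of [B] with algebraic multiplicity. *)
Definition eigenvalue_list (F : fieldType) (n : nat) (B : 'M[F]_n)
    (lambda : 'I_n -> F) : Prop :=
  char_poly B = \prod_(i < n) ('X - (lambda i)%:P).

Definition mean_trace (F : fieldType) (n : nat) (A : 'M[F]_n) : F :=
  \tr A / n%:R.

(* Main.v *)
Require Import Defs.
From mathcomp Require Import all_boot all_order all_algebra.
From mathcomp Require Import reals complex.
From mathcomp Require Import ring.
Set Implicit Arguments. Unset Strict Implicit. Unset Printing Implicit Defensive.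
Import Order.TTheory GRing.Theory Num.Theory.
Local Open Scope ring_scope.

(** Translating by the mean trace turns an eigenvalue [z] of [A] into an
    eigenvalue [w] of a trace-free matrix [B], so [w] is one of the [lambda i],
    say [lambda k], and [lambda k] is minus the sum of the [n - 1] others.  With
    [m = 2r], the triangle inequality and the power mean inequality then give
      [|lambda k|^m <= c * sum over i <> k of |lambda i|^m],
      [c = (n - 1)^(m - 1)].
    Adding [c * |lambda k|^m] to both sides yields
      [(1 + c) * |lambda k|^m <= c * sum over all i of |lambda i|^m],
    and the bound follows by dividing by [1 + c] and extracting an [m]-th root.
    The power mean inequality ([power_mean_sum]) is proved by induction on the
    exponent from Chebyshev's sum inequality ([chebyshev_sum_expr]). *)

(** The two factors have the same sign since powers are monotone on nonnegative
    elements; algebraically, [x - y] divides [x ^+ m - y ^+ m] with a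
    nonnegative quotient. *)
Lemma subr_mul_subrX_ge0 (F : numDomainType) (x y : F) (m : nat) :
  0 <= x -> 0 <= y -> 0 <= (x - y) * (x ^+ m - y ^+ m).
Proof.
move=> x0 y0; rewrite subrXX mulrA -expr2 mulr_ge0 //.
  by apply: real_exprn_even_ge0 => //; rewrite rpredB // ger0_real.
by apply: sumr_ge0 => i _; rewrite mulr_ge0 // exprn_ge0.
Qed.

(** Chebyshev's sum inequality for a family and its powers: twice the
    difference of the two sides is the sum over all pairs [(i, j)] of the
    nonnegative products [(x i - x j) * (x i ^+ m - x j ^+ m)]. *)
Lemma chebyshev_sum_expr (F : numDomainType) (I : finType) (P : pred I)
    (x : I -> F) (m : nat) :
  (forall i, 0 <= x i) ->
  (\sum_(i | P i) x i) * (\sum_(i | P i) x i ^+ m) <=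
    #|P|%:R * \sum_(i | P i) x i ^+ m.+1.
Proof.
move=> x0.
have : 0 <= \sum_(i | P i) \sum_(j | P j) (x i - x j) * (x i ^+ m - x j ^+ m).
  by apply: sumr_ge0 => i _; apply: sumr_ge0 => j _; apply: subr_mul_subrX_ge0.
set S1 := \sum_(i | P i) x i; set Sm := \sum_(i | P i) x i ^+ m.
set SM := \sum_(i | P i) x i ^+ m.+1.
have -> : \sum_(i | P i) \sum_(j | P j) (x i - x j) * (x i ^+ m - x j ^+ m)
          = (#|P|%:R * SM - S1 * Sm) *+ 2.
  have inner i : \sum_(j | P j) (x i - x j) * (x i ^+ m - x j ^+ m)
      = #|P|%:R * x i ^+ m.+1 - x i * Sm + (SM - S1 * x i ^+ m).
    rewrite mulr_natl -sumr_const mulr_sumr mulr_suml -!sumrB -big_split /=.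
    by apply: eq_bigr => j _; rewrite !exprS; ring.
  rewrite (eq_bigr _ (fun i _ => inner i)) big_split !sumrB /=.
  rewrite -!mulr_sumr -mulr_suml sumr_const -[SM *+ _]mulr_natl -/S1 -/Sm -/SM.
  ring.
by rewrite pmulrn_lge0 // subr_ge0.
Qed.

(** Each step multiplies the inequality by the sum of the [x i] and absorbs
    the extra factor with Chebyshev's inequality. *)
Lemma power_mean_sum (F : numDomainType) (I : finType) (P : pred I)
    (x : I -> F) (m : nat) :
  (forall i, 0 <= x i) ->
  (\sum_(i | P i) x i) ^+ m.+1 <= #|P|%:R ^+ m * \sum_(i | P i) x i ^+ m.+1.
Proof.
move=> x0; elim: m => [|m IHm].
  by rewrite expr0 mul1r expr1; apply: ler_sum => i _; rewrite expr1.
rewrite exprS; apply: (le_trans (ler_wpM2l _ IHm)); first exact: sumr_ge0.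
rewrite mulrCA exprSr -mulrA ler_wpM2l ?exprn_ge0 //.
exact: chebyshev_sum_expr.
Qed.

(** In a zero-sum family, a term is minus the sum of the others, so the power
    mean inequality bounds it; adding [c] times its own power, with
    [c = (n - 1) ^ m], completes the right-hand sum and
    produces the factor [c / (1 + c)]. *)
Lemma zero_sum_norm_expr_le (F : numFieldType) (n m : nat)
    (lambda : 'I_n -> F) (k : 'I_n) :
  \sum_i lambda i = 0 ->
  `|lambda k| ^+ m.+1 <=
    (n%:R - 1) ^+ m / (1 + (n%:R - 1) ^+ m) * \sum_i `|lambda i| ^+ m.+1.
Proof.
move=> sum0.
have card_others : #|predC1 k|%:R = n%:R - 1 :> F.
  by rewrite cardC1 card_ord -subn1 natrB // (leq_ltn_trans _ (ltn_ord k)).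
set c := (n%:R - 1) ^+ m.
have c_ge0 : 0 <= c by rewrite exprn_ge0 // -card_others ler0n.
have norm_le : `|lambda k| <= \sum_(i | i != k) `|lambda i|.
  move: sum0; rewrite (bigD1 k) //= => /eqP; rewrite addr_eq0 => /eqP ->.
  by rewrite normrN; apply: ler_norm_sum.
have power_le :
    `|lambda k| ^+ m.+1 <= c * \sum_(i | i != k) `|lambda i| ^+ m.+1.
  apply: le_trans (_ : (\sum_(i | i != k) `|lambda i|) ^+ m.+1 <= _).
    by rewrite lerXn2r // nnegrE // sumr_ge0.
  by rewrite /c -card_others; apply: power_mean_sum.
rewrite mulrAC ler_pdivlMr ?ltr_wpDr // (bigD1 k) //= mulrDr mulrDr mulr1.
by rewrite addrC [c * _]mulrC lerD2l.
Qed.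

Lemma eigenvalue_subM (F : fieldType) (n : nat) (A : 'M[F]_n) (a z : F) :
  eigenvalue A z -> eigenvalue (A - a%:M) (z - a).
Proof.
case/eigenvalueP=> v vA v_neq0; apply/eigenvalueP; exists v => //.
by rewrite mulmxBr vA mul_mx_scalar scalerBl.
Qed.

Lemma eigenvalue_list_mem (F : fieldType) (n : nat) (B : 'M[F]_n)
    (lambda : 'I_n -> F) (w : F) :
  eigenvalue_list B lambda -> eigenvalue B w -> exists k, w = lambda k.
Proof.
move=> lambdaP; rewrite eigenvalue_root_char lambdaP.
rewrite -(big_map lambda xpredT (fun x => 'X - x%:P)) root_prod_XsubC.
by case/mapP=> k _ ->; exists k.
Qed.

(** Both sides are read off, up to sign, from the coefficient of ['X^(n - 1)]
    in the characteristic polynomial. *)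
Lemma eigenvalue_list_sum (F : fieldType) (n : nat) (B : 'M[F]_n)
    (lambda : 'I_n -> F) :
  (0 < n)%N -> eigenvalue_list B lambda -> \sum_i lambda i = \tr B.
Proof.
move=> n_gt0 lambdaP; apply: oppr_inj; rewrite -char_poly_trace // lambdaP.
rewrite -(big_map lambda xpredT (fun x => 'X - x%:P)).
set s := map _ _.
have size_s : size s = n.
  by rewrite size_map [index_enum _]unlock -enumT size_enum_ord.
have := @coefPn_prod_XsubC _ s; rewrite size_s -lt0n => -> //.
by rewrite big_map.
Qed.

Lemma mxtrace_sub_mean_trace (F : numFieldType) (n : nat) (A : 'M[F]_n) :
  (0 < n)%N -> \tr (A - (mean_trace A)%:M) = 0.
Proof.
move=> n_gt0; rewrite raddfB /= mxtrace_scalar /mean_trace.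
by rewrite -[_ *+ n]mulr_natr divfK ?subrr // pnatr_eq0 -lt0n.
Qed.

Theorem theorem2p4 (R : realType) (n : nat) (n_gt0 : (0 < n)%N)
    (A : 'M[R[i]]_n) (lambda : 'I_n -> R[i])
    (lambdaP : eigenvalue_list (A - (mean_trace A)%:M) lambda)
    (r : nat) (r_gt0 : (0 < r)%N) (z : R[i]) :
  eigenvalue A z ->
  `|z - mean_trace A| <=
    (2 * r).-root
      ((n%:R - 1) ^+ (2 * r - 1) / (1 + (n%:R - 1) ^+ (2 * r - 1)) *
       \sum_(i < n) `|lambda i| ^+ (2 * r)).
Proof.
move=> /(eigenvalue_subM (mean_trace A)) /(eigenvalue_list_mem lambdaP) [k ->].
have sum0 : \sum_i lambda i = 0.
  by rewrite (eigenvalue_list_sum n_gt0 lambdaP) mxtrace_sub_mean_trace.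
have m_gt0 : (0 < 2 * r)%N by rewrite muln_gt0.
have := zero_sum_norm_expr_le (2 * r - 1) k sum0.
rewrite subn1 prednK // => bound.
rewrite -[leLHS](rootCK m_gt0) -rootCX //.
by rewrite ler_rootC // nnegrE ?exprn_ge0 // (le_trans _ bound) // exprn_ge0.
Qed.
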